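(* There exist fixed real-valued functions $r_1,\dots,r_{d-1}$ on $\mathbb{R}^d$ with $\sum_{i=1}^{d-1}r_i^2\le 1$, such that the following holds for every $U(1)$ connection $A$ on $\mathbb{R}^d$ which is pure gauge at infinity. There are real functions $\theta_1,\dots,\theta_{d-1},\bar\theta$ on $\mathbb{R}^d$ with $A=-\sum_{i=1}^{d-1}\theta_i\,dr_i^2+d\bar\theta$, and a universal matrix for $A$ is given by the $d\times1$ matrix $$U=\begin{pmatrix} r_1e^{-i(\theta_1+\theta_d)}\\ r_2e^{-i(\theta_2+\theta_d)}\\ \vdots\\ r_{d-1}e^{-i(\theta_{d-1}+\theta_d)}\\ r_de^{-i\theta_d}\end{pmatrix},$$ where $r_d^2=1-\sum_{i=1}^{d-1}r_i^2$ and $\theta_d=\bar\theta-\sum_{i=1}^{d-1}r_i^2\theta_i$; that is, $U^\dagger U=1$ and $A=iU^\dagger dU$.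
   Context: All functions and forms are smooth. A $U(1)$ connection on $\mathbb{R}^d$ is identified with a real 1-form $A$. ''Pure gauge at infinity'' means that there is a real function $\chi$ such that the components of $A-d\chi$ tend to $0$ as $|x|\to\infty$. A universal matrix for $A$ is an $m\times1$ complex matrix valued function $U$ with $U^\dagger U=1$ and $A=iU^\dagger dU$. The functions $r_i$ are fixed, meaning they do not depend on $A$. The notation $dr_i^2$ means $d(r_i^2)$. *)

(* Defs.v *)
(* R^d is 'rV[R]_n.+1 with d = n.+1, for R : realType, and C is R[i]. *)
From mathcomp Require Import all_boot all_order all_algebra.
From mathcomp Require Import all_classical all_reals all_analysis.
From mathcomp Require Export complex.
Set Implicit Arguments.
Unset Strict Implicit.
Unset Printing Implicit Defensive.
Import Order.TTheory GRing.Theory Num.Theory numFieldNormedType.Exports.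
Local Open Scope classical_set_scope.
Local Open Scope ring_scope.
Local Open Scope complex_scope.
Local Open Scope sesquilinear_scope.

Section Calculus.
Context {R : realType} {n : nat}.
Notation E := 'rV[R]_n.+1.

Definition partial (j : 'I_n.+1) (f : E -> R) (x : E) : R :=
  'D_(delta_mx 0 j) f x.

Fixpoint Ck (k : nat) (f : E -> R) : Prop :=
  continuous f /\
  if k is k'.+1 then
    forall j, (forall x, derivable f x (delta_mx 0 j)) /\ Ck k' (partial j f)
  else True.

Definition smooth (f : E -> R) : Prop := forall k, Ck k f.

(* A real 1-form is given by its components in the basis dx_0, ..., dx_n. *)
Definition smooth_form (A : E -> 'rV[R]_n.+1) : Prop :=
  forall j, smooth (fun x => A x 0 j).

Definition ext_d (f : E -> R) (x : E) : 'rV[R]_n.+1 := \row_j partial j f x.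

(* The filter |x| -> oo; the library norm on row vectors is the sup norm, which
   gives the same filter as the Euclidean norm. *)
Definition infinity_nbhs : set_system E :=
  [set P | exists M : R, forall x, M < `|x| -> P x].

#[global] Instance infinity_nbhs_filter : Filter infinity_nbhs.
Proof.
split; first by exists 0.
- move=> P Q [M HP] [N HQ]; exists (Num.max M N) => x.
  by rewrite gt_max => /andP[/HP ? /HQ ?].
- by move=> P Q PQ [M HP]; exists M => x /HP /PQ.
Qed.

Definition pure_gauge_at_infinity (A : E -> 'rV[R]_n.+1) : Prop :=
  exists2 chi : E -> R, smooth chi &
    forall j, (A x - ext_d chi x) 0 j @[x --> infinity_nbhs] --> (0 : R).

Definition partialC (j : 'I_n.+1) (f : E -> R[i]) (x : E) : R[i] :=
  partial j (fun y => complex.Re (f y)) x +i* partial j (fun y => complex.Im (f y)) x.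

Definition partial_mx m (j : 'I_n.+1) (U : E -> 'cV[R[i]]_m) (x : E) :
    'cV[R[i]]_m :=
  \col_k partialC j (fun y => U y k 0) x.

Definition smooth_mx m (U : E -> 'cV[R[i]]_m) : Prop :=
  forall k, smooth (fun x => complex.Re (U x k 0)) /\ smooth (fun x => complex.Im (U x k 0)).

(* The equation A = i U^dagger dU is stated on each dx_j component, as an
   equality of 1 x 1 matrices. *)
Definition universal_matrix m (A : E -> 'rV[R]_n.+1) (U : E -> 'cV[R[i]]_m) :
    Prop :=
  [/\ smooth_mx U,
      forall x, (U x)^t* *m U x = 1%:M &
      forall x j, ((A x 0 j)%:C)%:M = 'i%C *: ((U x)^t* *m partial_mx j U x)].

End Calculus.

(* e^(i t) *)
Definition expi {R : realType} (t : R) : R[i] := cos t +i* sin t.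

(* Main.v *)
Require Import Defs.
From mathcomp Require Import all_boot all_order all_algebra.
From mathcomp Require Import all_classical all_reals all_analysis.
From mathcomp Require Import ring.
Set Implicit Arguments.
Unset Strict Implicit.
Unset Printing Implicit Defensive.
Import Order.TTheory GRing.Theory Num.Theory numFieldNormedType.Exports.
Local Open Scope classical_set_scope.
Local Open Scope ring_scope.
Local Open Scope complex_scope.

(** Write the coordinates as [x_0, ..., x_n] with [n = d - 1]. If [r_i^2] depends
    on [x_i] alone and its derivative never vanishes, then the [n] forms
    [d(r_i^2)] span the forms in [dx_0, ..., dx_(n-1)] at every point, with
    smooth coefficients. The one remaining component [A_n] of a form [A] is
    absorbed into an exact form: let [thetabar] be the primitive of [A_n] along
    the last coordinate ([primitive_last]). Then [A - d(thetabar)] has no [dx_n]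
    component, and dividing its other components by those of [- d(r_i^2)] gives
    the [theta_i]. The amplitudes are chosen with [\sum_i r_i^2 < 1], so that
    [r_d], the square root of [1 - \sum_i r_i^2], is smooth too.

    The universal matrix is a computation: for a unit column with entries
    [rho_k e^(i psi_k)], the form [i U^dagger dU] is [- \sum_k rho_k^2 d(psi_k)]
    ([universal_matrix_polar]). With [psi_i = - (theta_i + theta_d)] for [i < d]
    and [psi_d = - theta_d] this is [\sum_i r_i^2 d(theta_i) + d(theta_d)], and
    the definition of [theta_d] turns it into
    [d(thetabar) - \sum_i theta_i d(r_i^2) = A].

    The analytic part is that [primitive_last f] is smooth with last partial
    derivative [f]; it follows from continuity and differentiability of
    integrals over the unit interval depending on a parameter
    ([continuous_integral01], [is_derive_integral01]), proved from the
    compactness of that interval. *)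

(** * Derivatives along lines *)

Section Lines.
Context {R : realType} {V : normedModType R}.
Implicit Types (f : V -> R) (x v : V).

(** A derivative along [v] is the ordinary derivative of the restriction to a
    line of direction [v]; this transports one-variable calculus (chain rule,
    mean value theorem, fundamental theorem) to partial derivatives. *)
Lemma is_derive_lineP f x v (t df : R) :
  is_derive (t *: v + x) v f df <-> is_derive t 1 (fun h => f (h *: v + x)) df.
Proof.
have e : (fun h : R => h^-1 *: (f (h *: v + (t *: v + x)) - f (t *: v + x))) =
    (fun h : R => h^-1 *: (f ((h *: 1 + t) *: v + x) - f (t *: v + x))).
  by apply/funext => h; rewrite addrA -scalerDl [h *: 1]mulr1.
split => -[d1 d2]; split.
- by move: d1; rewrite /derivable /= e.
- by move: d2; rewrite /derive /= e.
- by rewrite /derivable /= e.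
- by rewrite /derive /= e.
Qed.

Lemma is_derive_comp1 (phi : R -> R) f x v (df dphi : R) :
  is_derive x v f df -> is_derive (f x) 1 phi dphi ->
  is_derive x v (fun y => phi (f y)) (dphi * df).
Proof.
move=> Hf Hphi.
have -> : x = 0 *: v + x by rewrite scale0r add0r.
apply/is_derive_lineP.
have Hf' : is_derive (0 : R) 1 (fun h => f (h *: v + x)) df.
  by apply/is_derive_lineP; rewrite scale0r add0r.
have Hp : is_derive ((fun h : R => f (h *: v + x)) 0) 1 phi dphi.
  by rewrite scale0r add0r.
exact: (is_derive1_comp Hp Hf').
Qed.

Lemma is_derive_scale f x v (c df : R) :
  is_derive x v f df -> is_derive x (c *: v) f (c * df).
Proof.
move=> Hf.
have -> : x = 0 *: (c *: v) + x by rewrite scale0r add0r.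
apply/is_derive_lineP.
have -> : (fun h : R => f (h *: (c *: v) + x)) =
    (fun h : R => f (h *: v + x)) \o ( *%R^~ c).
  by apply/funext => h /=; rewrite scalerA.
rewrite mulrC; apply: is_derive1_comp.
  by apply/is_derive_lineP; rewrite mul0r scale0r add0r.
have -> : *%R^~ c = c \*: (id : R -> R) by apply/funext => h; rewrite /= mulrC.
by apply: is_derive_eq; rewrite -[RHS]mulr1.
Qed.
End Lines.

(** * Smooth functions *)

Section Smooth.
Context {R : realType} {n : nat}.
Notation E := 'rV[R]_n.+1.
Implicit Types (f g u : E -> R) (k : nat).

Lemma Ck_continuous k f : Ck k f -> continuous f.
Proof. by case: k => [|k] []. Qed.

Lemma CkS k f : Ck k.+1 f -> Ck k f.
Proof.
elim: k f => [|k IH] f; first by case.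
move=> [cf df]; split=> // j; have [d1 d2] := df j; split=> //.
exact: IH.
Qed.

Lemma Ck_is_derive k f j x : Ck k.+1 f ->
  is_derive x (delta_mx 0 j) f (partial j f x).
Proof. by move=> [_ /(_ j) [d _]]; apply: derivableP. Qed.

(** The way to establish regularity of a concrete function: exhibit its partial
    derivatives in closed form. *)
Lemma CkS_intro k f (f' : 'I_n.+1 -> E -> R) : continuous f ->
  (forall j x, is_derive x (delta_mx 0 j) f (f' j x)) ->
  (forall j, Ck k (f' j)) -> Ck k.+1 f.
Proof.
move=> cf df cf'; split=> // j; split=> [x|]; first by case: (df j x).
have -> : partial j f = f' j by apply/funext => x; case: (df j x).
exact: cf'.
Qed.

Lemma Ck_cst k (c : R) : Ck k (fun _ : E => c).
Proof.
elim: k c => [|k IH] c; first by split=> //; exact: cst_continuous.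
apply: (@CkS_intro _ _ (fun _ _ => 0)) => //; exact: cst_continuous.
Qed.

Lemma Ck_add k f g : Ck k f -> Ck k g -> Ck k (fun x => f x + g x).
Proof.
elim: k f g => [|k IH] f g Cf Cg.
  split=> // x.
  exact: (continuousD (@Ck_continuous _ _ Cf x) (@Ck_continuous _ _ Cg x)).
apply: (@CkS_intro _ _ (fun j x => partial j f x + partial j g x)) => [x|j x|j].
- exact: (continuousD (@Ck_continuous _ _ Cf x) (@Ck_continuous _ _ Cg x)).
- exact: (is_deriveD (Ck_is_derive j x Cf) (Ck_is_derive j x Cg)).
- by apply: IH; [exact: (Cf.2 j).2|exact: (Cg.2 j).2].
Qed.

Lemma Ck_mul k f g : Ck k f -> Ck k g -> Ck k (fun x => f x * g x).
Proof.
elim: k f g => [|k IH] f g Cf Cg.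
  split=> // x.
  exact: (continuousM (@Ck_continuous _ _ Cf x) (@Ck_continuous _ _ Cg x)).
apply: (@CkS_intro _ _ (fun j x =>
  f x * partial j g x + g x * partial j f x)) => [x|j x|j].
- exact: (continuousM (@Ck_continuous _ _ Cf x) (@Ck_continuous _ _ Cg x)).
- exact: (is_deriveM (Ck_is_derive j x Cf) (Ck_is_derive j x Cg)).
- apply: Ck_add; apply: IH; try exact: CkS.
    exact: (Cg.2 j).2.
  exact: (Cf.2 j).2.
Qed.

Lemma Ck_sum k (I : Type) (s : seq I) (F : I -> E -> R) :
  (forall i, Ck k (F i)) -> Ck k (fun x => \sum_(i <- s) F i x).
Proof.
move=> CF; elim: s => [|i s IH].
  under [X in Ck k X]funext do rewrite big_nil; exact: Ck_cst.
under [X in Ck k X]funext do rewrite big_cons; exact: Ck_add.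
Qed.

Lemma smooth_cst (c : R) : smooth (fun _ : E => c).
Proof. by move=> k; exact: Ck_cst. Qed.

Lemma smoothD f g : smooth f -> smooth g -> smooth (fun x => f x + g x).
Proof. by move=> sf sg k; exact: Ck_add. Qed.

Lemma smoothM f g : smooth f -> smooth g -> smooth (fun x => f x * g x).
Proof. by move=> sf sg k; exact: Ck_mul. Qed.

Lemma smooth_sum (I : Type) (s : seq I) (F : I -> E -> R) :
  (forall i, smooth (F i)) -> smooth (fun x => \sum_(i <- s) F i x).
Proof. by move=> sF k; apply: Ck_sum => i; exact: sF. Qed.

Lemma smoothN f : smooth f -> smooth (fun x => - f x).
Proof.
move=> sf; under [X in smooth X]funext do rewrite -mulN1r.
exact: smoothM (smooth_cst _) sf.
Qed.

Lemma smoothB f g : smooth f -> smooth g -> smooth (fun x => f x - g x).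
Proof. by move=> sf sg; exact: smoothD (smoothN sg). Qed.

Lemma smoothX f m : smooth f -> smooth (fun x => f x ^+ m).
Proof.
move=> sf; elim: m => [|m IH]; first exact: smooth_cst.
by under [X in smooth X]funext do rewrite exprS; exact: smoothM.
Qed.

Lemma smooth_partial j f : smooth f -> smooth (partial j f).
Proof. by move=> sf k; exact: ((sf k.+1).2 j).2. Qed.

Lemma smooth_is_derive j x f : smooth f ->
  is_derive x (delta_mx 0 j) f (partial j f x).
Proof. by move=> sf; exact: Ck_is_derive (sf 1%N). Qed.

Lemma smooth_continuous f : smooth f -> continuous f.
Proof. by move=> sf; exact: Ck_continuous (sf 0%N). Qed.

Lemma is_derive_coord j i (x : E) :
  is_derive x (delta_mx 0 j) (fun y : E => y 0 i) (i == j)%:R.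
Proof.
have -> : x = 0 *: delta_mx 0 j + x by rewrite scale0r add0r.
apply/is_derive_lineP.
have -> : (fun h : R => (h *: delta_mx 0 j + x) 0 i) =
    (i == j)%:R \*: (id : R -> R) + cst (x 0 i).
  by apply/funext => h; rewrite !mxE eqxx /= !fctE /= mulrC.
by apply: is_derive_eq; rewrite addr0 -[RHS]mulr1.
Qed.

Lemma smooth_coord i : smooth (fun x : E => x 0 i).
Proof.
case=> [|k]; first by split=> //; exact: coord_continuous.
apply: (@CkS_intro _ _ (fun j _ => (i == j)%:R)) => [|j x|j].
- exact: coord_continuous.
- exact: is_derive_coord.
- exact: Ck_cst.
Qed.

(** One step of the chain rule: the partial derivatives of [phi \o u] are
    [phi' \o u] times those of [u], so smoothness of the composite follows by
    induction as soon as [phi'] is expressed through functions already handled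
    at the previous order. *)
Lemma Ck_comp1 k (phi phi' : R -> R) u :
  (forall x, is_derive (u x) 1 phi (phi' (u x))) -> smooth u ->
  (if k is k'.+1 then Ck k' (fun x => phi' (u x)) else True) ->
  Ck k (fun x => phi (u x)).
Proof.
move=> dphi su.
have cphi : continuous (fun x => phi (u x)).
  move=> x; apply: (@continuous_comp _ _ _ u phi).
    exact: (@smooth_continuous _ su x).
  by apply/differentiable_continuous/derivable1_diffP; case: (dphi x).
case: k => [|k] Cphi'; first by split.
apply: (@CkS_intro _ _ (fun j x => phi' (u x) * partial j u x)) => // [j x|j].
- exact: (is_derive_comp1 (smooth_is_derive j x su) (dphi x)).
- by apply: Ck_mul => //; exact: smooth_partial.
Qed.

Lemma smooth_expR u : smooth u -> smooth (fun x => expR (u x)).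
Proof.
move=> su; have dE x : is_derive (u x) 1 expR (expR (u x)).
  exact: is_derive_expR.
by elim=> [|k IH]; apply: (Ck_comp1 dE su).
Qed.

Lemma smooth_cos_sin u : smooth u ->
  smooth (fun x => cos (u x)) /\ smooth (fun x => sin (u x)).
Proof.
move=> su.
pose cos' (t : R) := -1 * sin t.
have dc x : is_derive (u x) 1 cos (cos' (u x)).
  by rewrite /cos' mulN1r; exact: is_derive_cos.
have ds x : is_derive (u x) 1 sin (cos (u x)) by exact: is_derive_sin.
suff H k : Ck k (fun x => cos (u x)) /\ Ck k (fun x => sin (u x)).
  by split=> k; case: (H k).
elim: k => [|k [IHc IHs]].
  by split; [exact: (Ck_comp1 dc su)|exact: (Ck_comp1 ds su)].
split; last exact: (Ck_comp1 ds su).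
by apply: (Ck_comp1 dc su); exact: Ck_mul (Ck_cst k _) IHs.
Qed.

Lemma smoothV u : (forall x, u x != 0) -> smooth u ->
  smooth (fun x => (u x)^-1).
Proof.
move=> u0 su.
pose inv' (t : R) := -1 * (t^-1 * t^-1).
have dV x : is_derive (u x) 1 GRing.inv (inv' (u x)).
  apply: is_derive_eq; first exact: (@is_deriveV R id (u x) 1 1 (u0 x)).
  by rewrite /inv' [_ *: _]mulr1 mulN1r -invfM -expr2.
elim=> [|k IH]; apply: (Ck_comp1 dV su) => //.
by apply: (Ck_mul (Ck_cst k _)); exact: Ck_mul.
Qed.

Lemma smooth_sqrt u : (forall x, 0 < u x) -> smooth u ->
  smooth (fun x => Num.sqrt (u x)).
Proof.
move=> u0 su.
(* The derivative 1 / (2 sqrt t) is written with sqrt t in the numerator, so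
   that the induction hypothesis applies to it. *)
pose sqrt' (t : R) := 2^-1 * (Num.sqrt t * t^-1).
have dS x : is_derive (u x) 1 Num.sqrt (sqrt' (u x)).
  have H := is_derive1_sqrt (u0 x).
  apply: is_derive_eq; rewrite /sqrt' invfM; congr (_ * _).
  rewrite -{3}[u x]sqr_sqrtr ?ltW // expr2 invfM mulrA divff ?mul1r //.
  by rewrite gt_eqF // sqrtr_gt0.
elim=> [|k IH]; apply: (Ck_comp1 dS su) => //.
apply: (Ck_mul (Ck_cst k _)); apply: Ck_mul => //.
by apply: smoothV => // x; rewrite gt_eqF.
Qed.

Lemma partialD f g j x : smooth f -> smooth g ->
  partial j (fun y => f y + g y) x = partial j f x + partial j g x.
Proof.
move=> sf sg.
by have [_] := is_deriveD (smooth_is_derive j x sf) (smooth_is_derive j x sg).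
Qed.

Lemma partialN f j x : smooth f ->
  partial j (fun y => - f y) x = - partial j f x.
Proof. by move=> sf; have [_] := is_deriveN (smooth_is_derive j x sf). Qed.

Lemma partialM f g j x : smooth f -> smooth g ->
  partial j (fun y => f y * g y) x = f x * partial j g x + g x * partial j f x.
Proof.
move=> sf sg.
by have [_] := is_deriveM (smooth_is_derive j x sf) (smooth_is_derive j x sg).
Qed.

Lemma partial_sum m (F : 'I_m -> E -> R) j x : (forall i, smooth (F i)) ->
  partial j (fun y => \sum_i F i y) x = \sum_i partial j (F i) x.
Proof.
move=> sF; have [_] := is_derive_sum (fun i => smooth_is_derive j x (sF i)).
by rewrite fct_sumE.
Qed.

End Smooth.

(** * Integrals depending on a parameter *)

Section UnitIntegral.
Context {R : realType}.
Local Notation mu := (@lebesgue_measure R).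
Implicit Types f g : R -> R.

Definition integral01 (f : R -> R) : R := \int[mu]_(s in `[0, 1]) f s.

Lemma integrable01 f : continuous f -> mu.-integrable `[0, 1] (EFin \o f).
Proof.
move=> cf; apply: continuous_compact_integrable; first exact: segment_compact.
exact: continuous_subspaceT.
Qed.

Lemma integral01Z (c : R) f : continuous f ->
  integral01 (fun s => c * f s) = c * integral01 f.
Proof. by move=> cf; rewrite /integral01 RintegralZl //; exact: integrable01. Qed.

Lemma integral01B f g : continuous f -> continuous g ->
  integral01 (fun s => f s - g s) = integral01 f - integral01 g.
Proof.
by move=> cf cg; rewrite /integral01 RintegralB //; exact: integrable01.
Qed.

Lemma integral01D f g : continuous f -> continuous g ->
  integral01 (fun s => f s + g s) = integral01 f + integral01 g.
Proof.
by move=> cf cg; rewrite /integral01 RintegralD //; exact: integrable01.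
Qed.

Lemma integral01_norm_le f (e : R) : continuous f ->
  (forall s, s \in `[0, 1] -> `|f s| <= e) -> `|integral01 f| <= e.
Proof.
move=> cf fe.
have cnf : continuous (fun s => `|f s|).
  by move=> s; apply: continuous_comp (cf s) _; exact: norm_continuous.
apply: le_trans (le_normr_Rintegral _ (integrable01 cf)) _ => //.
apply: (@le_trans _ _ (\int[mu]_(s in `[0, 1]) e)).
  apply: le_Rintegral => //; first exact: integrable01.
  by apply: (@integrable01 (cst e)); exact: cst_continuous.
rewrite Rintegral_cst //= lebesgue_measure_itv /= lte_fin ltr01.
by rewrite oppr0 adde0 mulr1.
Qed.

Lemma FTC01 f (F : R -> R) : continuous f ->
  (forall s : R, is_derive s 1 F (f s)) -> integral01 f = F 1 - F 0.
Proof.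
move=> cf dF.
have cF : continuous F.
  move=> s; apply/differentiable_continuous/derivable1_diffP.
  by case: (dF s).
rewrite /integral01 /Rintegral (@continuous_FTC2 _ f F) //.
- exact: continuous_subspaceT.
- split.
  + by move=> s _; case: (dF s).
  + by apply: cvg_at_right_filter; exact: cF.
  + by apply: cvg_at_left_filter; exact: cF.
- by move=> s _; rewrite derive1E; case: (dF s).
Qed.

(** The mean value theorem between [0] and [h], for [h] of either sign. *)
Lemma MVT_increment (F f : R -> R) (h : R) :
  (forall s : R, is_derive s 1 F (f s)) ->
  exists2 c, `|c| <= `|h| & F h - F 0 = f c * h.
Proof.
move=> dF.
have cF (A : set R) : {within A, continuous F}.
  apply: continuous_subspaceT => s.
  apply/differentiable_continuous/derivable1_diffP.
  by case: (dF s).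
have [h0|h0] := leP 0 h.
  have [c] := MVT_segment h0 (fun x _ => dF x) (cF _).
  rewrite in_itv /= subr0 => /andP[c0 ch] e; exists c => //.
  by rewrite !ger0_norm.
have [c] := MVT_segment (ltW h0) (fun x _ => dF x) (cF _).
rewrite in_itv /= sub0r => /andP[hc c0] e; exists c.
  by rewrite !ler0_norm ?lerN2 // ltW.
by rewrite -opprB e mulrN opprK.
Qed.

End UnitIntegral.

Section ParametricIntegral.
Context {R : realType} {V : normedModType R}.
Implicit Types (g : V -> R -> R) (x v : V).

(** By compactness of the unit interval, a jointly continuous [g] is continuous
    in its first argument uniformly in the second. Both limit exchanges below
    rest on this. *)
Lemma near_unif01 g x (e : R) : continuous (fun p : V * R => g p.1 p.2) ->
  0 < e -> \forall y \near x, forall s, s \in `[0, 1] -> `|g y s - g x s| < e.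
Proof.
move=> cg e0.
have := @segment_compact R 0 1; rewrite compact_near_coveringP.
move=> /(_ V (nbhs x) (fun y s => `|g y s - g x s| < e) _); apply => s _.
have /cvgrPdist_lt /(_ (e / 2)) := cg (x, s).
rewrite divr_gt0 // => /(_ isT) [[A B] /= [Ax Bs] AB].
exists (B, A) => //= -[t y] /= [Bt Ay].
have := AB (y, t) (conj Ay Bt).
have := AB (x, t) (conj (nbhs_singleton Ax) Bt).
rewrite /= => h1 h2.
have -> : g y t - g x t = (g x s - g x t) - (g x s - g y t) by ring.
by rewrite (le_lt_trans (ler_normB _ _)) // [e]splitr ltrD.
Qed.

Lemma continuous_slice g x : continuous (fun p : V * R => g p.1 p.2) ->
  continuous (g x).
Proof.
move=> cg s.
apply: (@continuous_comp _ _ _ (fun t : R => (x, t))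
  (fun p : V * R => g p.1 p.2)).
  exact: (cvg_pair (cvg_cst (x : V)) (cvg_id (F := nbhs s))).
exact: cg.
Qed.

Lemma continuous_integral01 g : continuous (fun p : V * R => g p.1 p.2) ->
  continuous (fun x => integral01 (g x)).
Proof.
move=> cg x; apply/cvgrPdist_le => e e0.
have := near_unif01 x cg e0; apply: filterS => y ye.
rewrite -integral01B; [|exact: continuous_slice..].
apply: integral01_norm_le => [s|s s01].
  by apply: (@continuousB _ _ _ (g x) (g y)); exact: continuous_slice.
by rewrite distrC ltW // ye.
Qed.

(** Differentiation under the integral sign. By the mean value theorem the
    difference quotient of [g ^~ s] at [x] equals [g' y s] for some [y] on the
    segment from [x] to [h *: v + x], hence tends to [g' x s] uniformly in [s]
    by [near_unif01]. *)
Lemma is_derive_integral01 g g' x v :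
  continuous (fun p : V * R => g p.1 p.2) ->
  continuous (fun p : V * R => g' p.1 p.2) ->
  (forall y s, is_derive y v (g ^~ s) (g' y s)) ->
  is_derive x v (fun y => integral01 (g y)) (integral01 (g' x)).
Proof.
move=> cg cg' dg.
suff H : h^-1 *: (integral01 (g (h *: v + x)) - integral01 (g x)) @[h --> 0^'] -->
    integral01 (g' x).
  by split; [apply/cvg_ex; eexists; exact: H|exact: cvg_lim H].
apply/cvgrPdist_le => e e0.
have lc : (fun h : R => h *: v + x) @ 0 --> x.
  rewrite -[X in _ --> X]add0r -(scale0r v).
  by apply: cvgD; [apply: cvgZr_tmp; exact: cvg_id|exact: cvg_cst].
have /nbhs_ballP[d /= d0 dP] := lc _ (near_unif01 x cg' e0).
near=> h.
have h0 : h != 0 by near: h; exact: nbhs_dnbhs_neq.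
have hd : `|h| < d.
  near: h; apply: dnbhs0_lt => //.
have E : h^-1 *: (integral01 (g (h *: v + x)) - integral01 (g x)) =
   integral01 (fun s => h^-1 * (g (h *: v + x) s - g x s)).
  rewrite -integral01B ?integral01Z //; [|exact: continuous_slice..].
  by move=> s; apply: (@continuousB _ _ _ (g _) (g _)); exact: continuous_slice.
have cq : continuous (fun s => h^-1 * (g (h *: v + x) s - g x s)).
  move=> s; have c1 := @continuous_slice g (h *: v + x) cg.
  have c2 := @continuous_slice g x cg.
  apply: (continuousM (@cst_continuous _ _ (h^-1) s)).
  exact: (continuousB (@c1 s) (@c2 s)).
rewrite E -integral01B //; last exact: continuous_slice.
apply: integral01_norm_le => [s|s s01].
  by apply: (@continuousB _ _ _ (g' x)); [exact: continuous_slice|exact: cq].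
have [c ch] := @MVT_increment R (fun t => g (t *: v + x) s)
   (fun t => g' (t *: v + x) s) h
   (fun t => (is_derive_lineP _ _ _ _ _).1 (dg _ s)).
rewrite scale0r add0r => ->.
rewrite mulrCA mulVf // mulr1 distrC ltW //.
apply: dP s01; rewrite /= -ball_normE /= sub0r normrN.
exact: le_lt_trans ch hd.
Unshelve. all: by end_near. Qed.

End ParametricIntegral.

(** * Primitives along the last coordinate *)

Section Primitive.
Context {R : realType} {n : nat}.
Notation E := 'rV[R]_n.+1.
Implicit Types (f : E -> R) (x y : E).

Let e_last : E := delta_mx 0 ord_max.

Definition rescale_last (s : R) x : E :=
  s *: (x 0 ord_max *: e_last) + (x - x 0 ord_max *: e_last).

(** [primitive_last] is [x_n] times the moment of order 0. Higher moments appear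
    because each derivative in the last direction brings out a factor [s]; the
    family of all moments is closed under partial derivatives. *)
Definition rescaled_moment (m : nat) f x : R :=
  integral01 (fun s => s ^+ m * f (rescale_last s x)).

Lemma rescale_last_line s h j x : rescale_last s (h *: delta_mx 0 j + x) =
  h *: (s ^+ (j == ord_max) *: delta_mx 0 j) + rescale_last s x.
Proof.
rewrite /rescale_last /e_last; apply/rowP => i; rewrite !mxE !eqxx /=.
rewrite [ord_max == j]eq_sym; case: (eqVneq j ord_max) => [->|jn] /=; first ring.
by case: (eqVneq i ord_max) => [->|_] /=; ring.
Qed.

Lemma rescale_last1 x : rescale_last 1 x = x.
Proof. by rewrite /rescale_last scale1r addrC subrK. Qed.

Lemma continuous_rescaled m f : continuous f ->
  continuous (fun p : E * R => p.2 ^+ m * f (rescale_last p.2 p.1)).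
Proof.
move=> cf p.
have c2 : {for p, continuous (fun p : E * R => p.2)} by exact: cvg_snd.
have c1 : {for p, continuous (fun p : E * R => p.1)} by exact: cvg_fst.
have cx : {for p, continuous (fun p : E * R => p.1 0 ord_max)}.
  by apply: (@continuous_comp _ _ _ fst (fun x : E => x 0 ord_max)) => //;
    exact: coord_continuous.
have ce : {for p, continuous (fun p : E * R => p.1 0 ord_max *: e_last)}.
  exact: continuousZr_tmp.
have cr : {for p, continuous (fun p : E * R => rescale_last p.2 p.1)}.
  exact: (continuousD (continuousZ c2 ce) (continuousB c1 ce)).
have cp : {for p, continuous (fun p : E * R => p.2 ^+ m)}.
  by apply: (@continuous_comp _ _ _ snd (fun s : R => s ^+ m)) => //;
    exact: exprn_continuous.
apply: (continuousM cp).
by apply: (@continuous_comp _ _ _ _ f) => //; exact: cf.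
Qed.

Lemma is_derive_rescaled_moment m f j x : smooth f ->
  is_derive x (delta_mx 0 j) (rescaled_moment m f)
    (rescaled_moment (m + (j == ord_max)) (partial j f) x).
Proof.
move=> sf.
apply: (@is_derive_integral01 _ _ (fun y s => s ^+ m * f (rescale_last s y))
  (fun y s => s ^+ (m + (j == ord_max)) * partial j f (rescale_last s y))).
- exact/continuous_rescaled/smooth_continuous.
- exact/continuous_rescaled/smooth_continuous/smooth_partial.
move=> y s; rewrite exprD -mulrA.
apply: (@is_deriveZ _ _ _ (fun y => f (rescale_last s y))).
rewrite -[y in is_derive y]add0r -(scale0r (delta_mx 0 j)).
apply/is_derive_lineP.
have H : is_derive (0 *: (s ^+ (j == ord_max) *: delta_mx 0 j) + rescale_last s y)
    (s ^+ (j == ord_max) *: delta_mx 0 j) f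
    (s ^+ (j == ord_max) * partial j f (rescale_last s y)).
  by rewrite scale0r add0r; exact: is_derive_scale (smooth_is_derive _ _ sf).
have := (is_derive_lineP _ _ _ _ _).1 H.
by congr is_derive; apply/funext => h; rewrite rescale_last_line.
Qed.

Lemma smooth_rescaled_moment m f : smooth f -> smooth (rescaled_moment m f).
Proof.
move=> sf k; elim: k m f sf => [|k IH] m f sf.
  split=> //; apply: (@continuous_integral01 _ _
    (fun x s => s ^+ m * f (rescale_last s x))).
  exact/continuous_rescaled/smooth_continuous.
apply: CkS_intro => [|j x|j].
- exact: (@Ck_continuous _ _ k _ (IH m f sf)).
- exact: is_derive_rescaled_moment.
- exact/IH/smooth_partial.
Qed.

(** The integral of [f] along the last coordinate from [0] to [x_n], with the
    variable rescaled to the unit interval: the domain of integration no longer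
    depends on [x], and the sign of [x_n] needs no case distinction. *)
Definition primitive_last f x : R := x 0 ord_max * rescaled_moment 0 f x.

Lemma smooth_primitive_last f : smooth f -> smooth (primitive_last f).
Proof.
by move=> sf; exact: smoothM (smooth_coord _) (smooth_rescaled_moment _ sf).
Qed.

(** The derivative of [x_n] times the integral of [f (rescale_last s x)] is the
    integral of the [s]-derivative of [s * f (rescale_last s x)], that is
    [f x] by the fundamental theorem of calculus. *)
Lemma partial_primitive_last f : smooth f ->
  partial ord_max (primitive_last f) = f.
Proof.
move=> sf; apply/funext => x.
have [_ d] : is_derive x (delta_mx 0 ord_max) (primitive_last f)
    (x 0 ord_max * rescaled_moment 1 (partial ord_max f) x +
     rescaled_moment 0 f x).
  have := is_deriveM (is_derive_coord ord_max ord_max x)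
    (is_derive_rescaled_moment 0 ord_max x sf).
  by move=> H; apply: is_derive_eq; rewrite eqxx [_ *: 1]mulr1.
rewrite /partial d /rescaled_moment.
have cm m (g : E -> R) : smooth g ->
    continuous (fun s : R => s ^+ m * g (rescale_last s x)).
  move=> sg.
  apply: (@continuous_slice _ _ (fun x s => s ^+ m * g (rescale_last s x)) x).
  exact/continuous_rescaled/smooth_continuous.
have c0 := cm 0%N _ sf; have c1 := cm 1%N _ (smooth_partial ord_max sf).
have c1' : continuous (fun s : R =>
    x 0 ord_max * (s ^+ 1 * partial ord_max f (rescale_last s x))).
  by move=> s; exact: (continuousM (@cst_continuous _ _ (x 0 ord_max) s) (@c1 s)).
rewrite -integral01Z // -integral01D //.
have dF (s : R) : is_derive s 1 (fun s : R => s * f (rescale_last s x))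
    (x 0 ord_max * (s ^+ 1 * partial ord_max f (rescale_last s x)) +
     s ^+ 0 * f (rescale_last s x)).
  have dl : is_derive s 1 (fun s : R => f (rescale_last s x))
      (x 0 ord_max * partial ord_max f (rescale_last s x)).
    exact: ((is_derive_lineP f (x - x 0 ord_max *: e_last) _ s _).1
      (is_derive_scale _ (smooth_is_derive ord_max (rescale_last s x) sf))).
  apply: (is_derive_eq (is_deriveM (is_derive_id s 1) dl)).
  by rewrite [_ *: 1]mulr1 expr1 expr0 mul1r [_ *: _]mulrCA.
rewrite (FTC01 _ dF); first by rewrite mul1r mul0r subr0 rescale_last1.
by move=> s; exact: (continuousD (@c1' s) (@c0 s)).
Qed.

End Primitive.

(** * Universal matrices in polar form *)

Section PolarUniversalMatrix.
Context {R : realType} {n : nat}.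
Notation E := 'rV[R]_n.+1.

Lemma conj_polar_partial (j : 'I_n.+1) (rho psi : E -> R) x :
  smooth rho -> smooth psi ->
  ((rho x)%:C * expi (psi x))^* *
    partialC j (fun y => (rho y)%:C * expi (psi y)) x =
  (rho x * partial j rho x) +i* (rho x ^+ 2 * partial j psi x).
Proof.
move=> sr sp.
have dr := smooth_is_derive j x sr.
have dp := smooth_is_derive j x sp.
have [_ dc] := is_deriveM dr (is_derive_comp1 dp (is_derive_cos (psi x))).
have [_ ds] := is_deriveM dr (is_derive_comp1 dp (is_derive_sin (psi x))).
have eR : (fun y => complex.Re ((rho y)%:C * expi (psi y))) =
  rho * (fun y => cos (psi y)).
  by apply/funext => y /=; rewrite mul0r subr0.
have eI : (fun y => complex.Im ((rho y)%:C * expi (psi y))) =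
  rho * (fun y => sin (psi y)).
  by apply/funext => y /=; rewrite mul0r addr0.
rewrite /partialC eR eI [partial j (_ * _) x]dc [partial j (_ * _) x]ds /expi.
move: (partial j rho x) (partial j psi x) (cos2Dsin2 (psi x)) => r p.
move: (cos _) (sin _) => c s cs1.
apply/eqP; rewrite eq_complex /= /GRing.scale /=.
by apply/andP; split; apply/eqP; rewrite -[RHS]mul1r -cs1; ring.
Qed.

Lemma sum_complex m (F G : 'I_m -> R) :
  \sum_k (F k +i* G k) = (\sum_k F k) +i* (\sum_k G k).
Proof.
by apply: (big_ind3 (fun a b c => a = b +i* c)) => // ? ? ? ? ? ? -> ->.
Qed.

(** For a unit column with entries [rho_k e^(i psi_k)], the matrix [U^dagger dU]
    is the sum of the [rho_k d(rho_k) + i rho_k^2 d(psi_k)], and the real part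
    vanishes because the norm is constant. So [i U^dagger dU] is minus the
    average of the [d(psi_k)] with weights [rho_k^2]. *)
Lemma universal_matrix_polar m (rho psi : 'I_m -> E -> R) (A : E -> E) :
  (forall k, smooth (rho k)) -> (forall k, smooth (psi k)) ->
  (forall x, \sum_k rho k x ^+ 2 = 1) ->
  (forall x j, A x 0 j = - \sum_k rho k x ^+ 2 * partial j (psi k) x) ->
  universal_matrix A (fun x => \col_k ((rho k x)%:C * expi (psi k x))).
Proof.
move=> sr sp sum1 AE.
split.
- move=> k; have [sc ss] := smooth_cos_sin (sp k); split.
  + under [X in smooth X]funext do rewrite mxE /= mul0r subr0.
    exact: smoothM.
  + under [X in smooth X]funext do rewrite mxE /= mul0r addr0.
    exact: smoothM.
- move=> x; apply/matrixP => a b; rewrite !ord1 !mxE eqxx /=.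
  have -> : (1 : R[i]) = (\sum_k rho k x ^+ 2)%:C by rewrite sum1.
  rewrite (_ : _%:C = \sum_k (rho k x ^+ 2 +i* 0)); last first.
    by rewrite sum_complex big1_eq.
  apply: eq_bigr => k _; rewrite !mxE /expi.
  apply/eqP; rewrite eq_complex /=; apply/andP; split; apply/eqP; last ring.
  by rewrite -[RHS]mulr1 -(cos2Dsin2 (psi k x)); ring.
- move=> x j; apply/matrixP => a b; rewrite !ord1 !mxE eqxx /= mulr1n.
  have E k : (((\col_k ((rho k x)%:C * expi (psi k x))) ^t*)%sesqui 0 k *
      partial_mx j (fun y => \col_k ((rho k y)%:C * expi (psi k y))) x k 0) =
      (rho k x * partial j (rho k) x) +i* (rho k x ^+ 2 * partial j (psi k) x).
    rewrite !mxE -conj_polar_partial //; congr (_ * _).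
    by congr (partialC _ _ _); apply/funext => y; rewrite mxE.
  under eq_bigr do rewrite E.
  rewrite sum_complex AE.
  (* The real part is half the derivative of the constant \sum_k rho_k^2. *)
  have -> : \sum_k rho k x * partial j (rho k) x = 0.
    have : partial j (fun y => \sum_k rho k y * rho k y) x = 0.
      rewrite (_ : (fun y => _) = cst 1); first exact: derive_cst.
      by apply/funext => y; rewrite -[RHS](sum1 y); apply: eq_bigr.
    rewrite partial_sum => [|k]; last exact: smoothM.
    under eq_bigr do rewrite partialM //.
    by rewrite big_split /= -mulr2n => /eqP; rewrite mulrn_eq0 /= => /eqP.
  by apply/eqP; rewrite eq_complex /=; apply/andP; split; apply/eqP; ring.
Qed.
End PolarUniversalMatrix.

(** * The fixed amplitudes *)

Section Amplitudes.
Context {R : realType} {n : nat}.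
Notation E := 'rV[R]_n.+1.

(** The square must be a function of [x_i] alone, bounded, with a derivative that
    vanishes nowhere. Here it is proportional to [exp (- 2 exp x_i)], whose
    logarithmic derivative [- 2 exp x_i] is explicit, and the factor
    [1 / n.+1] leaves room below 1 for the sum of the [n] squares. *)
Definition amplitude (i : 'I_n) (x : E) : R :=
  n.+1%:R^-1 * expR (- expR (x 0 (lift ord_max i))).

Lemma smooth_amplitude i : smooth (amplitude i).
Proof.
apply: smoothM; first exact: smooth_cst.
exact/smooth_expR/smoothN/smooth_expR/smooth_coord.
Qed.

Lemma amplitude_gt0 i x : 0 < amplitude i x.
Proof. by rewrite mulr_gt0 ?expR_gt0 ?invr_gt0 ?ltr0n. Qed.

Lemma sum_amplitude_lt1 x : \sum_(i < n) amplitude i x ^+ 2 < 1.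
Proof.
apply: (@le_lt_trans _ _ (\sum_(i < n) n.+1%:R^-1)).
  apply: ler_sum => i _.
  have a0 := ltW (amplitude_gt0 i x).
  have a1 : amplitude i x <= n.+1%:R^-1.
    by rewrite /amplitude ler_piMr ?invr_ge0 ?ler0n // ?expR_le1 ?oppr_le0
      ?expR_ge0 //.
  apply: (le_trans _ (a1)); rewrite expr2 ler_piMr //.
  by apply: (le_trans a1); rewrite invf_le1 ?ltr0n // ler1n.
rewrite sumr_const card_ord -[_ *+ n]mulr_natl ltr_pdivrMr ?ltr0n //.
by rewrite mul1r ltr_nat.
Qed.

(** The radicand stays positive ([sum_amplitude_lt1]), so the square root is
    smooth. *)
Definition last_amplitude (x : E) : R :=
  Num.sqrt (1 - \sum_(i < n) amplitude i x ^+ 2).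

Lemma smooth_last_amplitude : smooth last_amplitude.
Proof.
apply: smooth_sqrt => [x|]; first by rewrite subr_gt0 sum_amplitude_lt1.
apply: smoothB; first exact: smooth_cst.
by apply: smooth_sum => i; apply: smoothX; exact: smooth_amplitude.
Qed.

Lemma partial_sqr_amplitude i j x :
  partial j (fun y => amplitude i y ^+ 2) x =
  (lift ord_max i == j)%:R *
    - (2 * expR (x 0 (lift ord_max i)) * amplitude i x ^+ 2).
Proof.
have sa := smooth_amplitude i.
under [X in partial j X]funext do rewrite expr2.
rewrite partialM //.
have d1 := is_derive_comp1 (is_derive_coord j (lift ord_max i) x)
  (is_derive_expR _).
have d2 := is_derive_comp1 (is_deriveN d1) (is_derive_expR _).
have [_ d3] := is_deriveZ (n.+1%:R^-1) d2.
rewrite [partial j (amplitude i) x]d3 /amplitude !fctE /= /GRing.scale /=.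
ring.
Qed.

End Amplitudes.

(** * The decomposition and the universal matrix *)

Theorem corollary3p4 (R : realType) (n : nat) :
  exists (r : 'I_n -> 'rV[R]_n.+1 -> R) (rd : 'rV[R]_n.+1 -> R),
    [/\ forall i, smooth (r i),
        smooth rd,
        forall x, \sum_(i < n) r i x ^+ 2 <= 1,
        forall x, rd x ^+ 2 = 1 - \sum_(i < n) r i x ^+ 2 &
        forall A : 'rV[R]_n.+1 -> 'rV[R]_n.+1,
          smooth_form A -> pure_gauge_at_infinity A ->
          exists (theta : 'I_n -> 'rV[R]_n.+1 -> R)
                 (thetabar : 'rV[R]_n.+1 -> R),
            let thetad x := thetabar x - \sum_(i < n) r i x ^+ 2 * theta i x in
            [/\ forall i, smooth (theta i),
                smooth thetabar,
                forall x,
                  A x = - (\sum_(i < n)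
                             theta i x *: ext_d (fun y => r i y ^+ 2) x)
                        + ext_d thetabar x &
                universal_matrix A (fun x => \col_(k < n.+1)
                  if unlift ord_max k is Some i
                  then (r i x)%:C * expi (- (theta i x + thetad x))
                  else (rd x)%:C * expi (- thetad x))]].
Proof.
exists amplitude, last_amplitude; split.
- exact: smooth_amplitude.
- exact: smooth_last_amplitude.
- by move=> x; exact/ltW/sum_amplitude_lt1.
- by move=> x; rewrite sqr_sqrtr // subr_ge0; exact/ltW/sum_amplitude_lt1.
move=> A sA _.
pose thetabar := primitive_last (fun x => A x 0 ord_max).
(* A - d(thetabar) has no last component; its i-th component is divided by
   minus the only nonzero component of d(r_i^2). *)
pose theta (i : 'I_n) x :=
  (A x 0 (lift ord_max i) - partial (lift ord_max i) thetabar x) *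
  (2 * expR (x 0 (lift ord_max i)) * amplitude i x ^+ 2)^-1.
have sthetabar : smooth thetabar by exact/smooth_primitive_last.
have stheta i : smooth (theta i).
  apply: smoothM; first by apply: smoothB => //; exact: smooth_partial.
  apply: smoothV => [x|].
    by rewrite gt_eqF // !mulr_gt0 ?expR_gt0 ?exprn_gt0 ?amplitude_gt0.
  apply: smoothM; last exact/smoothX/smooth_amplitude.
  by apply: smoothM; [exact: smooth_cst|exact/smooth_expR/smooth_coord].
have AE x j : A x 0 j = - (\sum_(i < n)
     theta i x * partial j (fun y => amplitude i y ^+ 2) x)
     + partial j thetabar x.
  under eq_bigr do rewrite partial_sqr_amplitude.
  case: (unliftP ord_max j) => [i|] ->.
    rewrite (bigD1 i) //= big1 ?addr0 => [|i' ne].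
      rewrite eqxx mul1r mulrN opprK divfK ?subrK //.
      by rewrite gt_eqF // !mulr_gt0 ?expR_gt0 ?exprn_gt0 ?amplitude_gt0.
    by rewrite (inj_eq lift_inj) (negbTE ne) mul0r mulr0.
  rewrite big1 ?oppr0 ?add0r ?[partial ord_max _]partial_primitive_last // => i _.
  by rewrite eq_sym (negbTE (neq_lift _ _)) mul0r mulr0.
exists theta, thetabar => thetad; split=> //.
  move=> x; apply/rowP => j; rewrite AE !mxE summxE.
  by congr (- _ + _); apply: eq_bigr => i _; rewrite !mxE.
have sthetad : smooth thetad.
  apply: smoothB => //; apply: smooth_sum => i; apply: smoothM => //.
  exact/smoothX/smooth_amplitude.
(* The last entry has no theta of its own; phase 0 there lets all the entries
   share one formula. *)
pose rho (k : 'I_n.+1) : 'rV[R]_n.+1 -> R :=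
  oapp amplitude last_amplitude (unlift ord_max k).
pose psi (k : 'I_n.+1) (x : 'rV[R]_n.+1) : R :=
  - (oapp theta (fun=> 0) (unlift ord_max k) x + thetad x).
have -> : (fun x => \col_(k < n.+1)
    if unlift ord_max k is Some i
    then (amplitude i x)%:C * expi (- (theta i x + thetad x))
    else (last_amplitude x)%:C * expi (- thetad x)) =
  (fun x => \col_k ((rho k x)%:C * expi (psi k x))).
  apply/funext => x; apply/colP => k; rewrite !mxE /rho /psi.
  by case: (unlift ord_max k) => //=; rewrite add0r.
have sumE (F : 'I_n.+1 -> R) :
    \sum_k F k = \sum_(i < n) F (lift ord_max i) + F ord_max.
  rewrite big_ord_recr /=; congr (_ + _); apply: eq_bigr => i _; congr F.
  by apply: val_inj; rewrite /= /bump leqNgt ltn_ord.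
apply: universal_matrix_polar => [k|k|x|x j].
- rewrite /rho; case: (unlift _ _) => [i|] /=; first exact: smooth_amplitude.
  exact: smooth_last_amplitude.
- apply/smoothN/smoothD => //; case: (unlift _ _) => [i|] //=.
  exact: smooth_cst.
- rewrite sumE /rho unlift_none /=.
  under eq_bigr do rewrite liftK /=.
  by rewrite sqr_sqrtr ?subr_ge0 ?ltW ?sum_amplitude_lt1 // addrC subrK.
rewrite sumE /rho /psi unlift_none /=.
have sq (i : 'I_n) : smooth (fun y : 'rV[R]_n.+1 => amplitude i y ^+ 2).
  exact/smoothX/smooth_amplitude.
have dthetad : partial j thetad x = partial j thetabar x - \sum_(i < n)
    (amplitude i x ^+ 2 * partial j (theta i) x +
     theta i x * partial j (fun y => amplitude i y ^+ 2) x).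
  have sM i : smooth (fun x => amplitude i x ^+ 2 * theta i x) by exact: smoothM.
  rewrite /thetad partialD //; last exact/smoothN/smooth_sum.
  rewrite partialN; last exact: smooth_sum.
  by rewrite partial_sum //; under eq_bigr do rewrite partialM //.
rewrite partialN; last exact: smoothD (smooth_cst 0) sthetad.
rewrite partialD //; last exact: smooth_cst.
have -> : partial j (fun=> 0) x = 0 by exact: derive_cst.
under eq_bigr => i _.
  rewrite liftK /= partialN; last exact: smoothD.
  rewrite partialD // mulrN mulrDr.
  over.
rewrite sqr_sqrtr ?subr_ge0 ?ltW ?sum_amplitude_lt1 //.
rewrite sumrN big_split /= -mulr_suml add0r dthetad big_split /= AE.
ring.
Qed.
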